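(* Let $\beta\in(0,d]$, let $Q$ be a cube in $\mathbb{R}^d$ and $f \in L^1(Q;\mathcal{H}^{\beta,Q}_\infty)$. Then for every $\lambda>0$ such that $$\lambda \geq \frac{1}{l(Q)^\beta} \int_Q |f| \, d\mathcal{H}^{\beta,Q}_\infty,$$ there exists a countable collection of non-overlapping cubes $\{ Q_k\}\subset \mathcal{D}(Q)$, each contained in $Q$, such that (1) $\lambda< \frac{1}{l(Q_k)^\beta} \int_{Q_k} |f| \, d\mathcal{H}^{\beta,Q}_\infty \leq 2^\beta \lambda$ for every $k$; (2) $|f(x)| \leq \lambda$ for $\mathcal{H}^\beta$-a.e. $x\in Q \setminus \bigcup_k Q_k$.
   Context: For a cube $Q=a+[0,\ell)^d$ (cubes are half-open), $\mathcal{D}(Q)=\{a+2^{-j}\ell(m+[0,1)^d): j\in\mathbb{Z}, m\in\mathbb{Z}^d\}$. $\mathcal{H}^{\beta,Q}_{\infty}(E)= \inf \{\sum_{i} l(Q_i)^\beta : E \subset \bigcup_{i} Q_i,\ Q_i \in \mathcal{D}(Q) \}$, $l(\cdot)$ the side length. For $f\ge0$ and a set $A$, $\int_A f\,d\mathcal{H}^{\beta,Q}_\infty=\int_0^\infty \mathcal{H}^{\beta,Q}_\infty(\{x\in A:f(x)>t\})\,dt$. $f$ is $\mathcal{H}^{\beta,Q}_\infty$-quasicontinuous if for every $\epsilon>0$ there is an open $O$ with $\mathcal{H}^{\beta,Q}_\infty(O)<\epsilon$ and $f|_{O^c}$ continuous; $L^1(Q;\mathcal{H}^{\beta,Q}_\infty)$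 is the set of such $f$ with $\int_{Q}|f|\,d\mathcal{H}^{\beta,Q}_\infty<\infty$. $\mathcal{H}^\beta$ denotes the $\beta$-dimensional Hausdorff measure. *)

(* Defs.v *)
From HB Require Import structures.
From mathcomp Require Import all_boot all_order all_algebra.
From mathcomp Require Import all_classical all_reals all_analysis.
Set Implicit Arguments. Unset Strict Implicit. Unset Printing Implicit Defensive.
Import Order.TTheory GRing.Theory Num.Theory.
Import numFieldNormedType.Exports.
Local Open Scope classical_set_scope.
Local Open Scope ring_scope.

Section Defs.
Variables (R : realType) (d : nat).
Notation pt := 'rV[R]_d.

Definition cube (a : pt) (l : R) : set pt :=
  [set x | forall i : 'I_d, a ord0 i <= x ord0 i < a ord0 i + l].

Definition dside (l : R) (j : int) : R := l * (2%:R ^ (- j)).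

Definition dcube (a : pt) (l : R) (j : int) (m : 'I_d -> int) : set pt :=
  cube (\row_i (a ord0 i + dside l j * (m i)%:~R)) (dside l j).

Definition Hcontent (beta : R) (a : pt) (l : R) (E : set pt) : \bar R :=
  ereal_inf [set s | exists (j : nat -> int) (m : nat -> 'I_d -> int),
      E `<=` \bigcup_n dcube a l (j n) (m n) /\
      s = (\sum_(n <oo) ((dside l (j n)) `^ beta)%:E)%E].

Definition choquet (beta : R) (a : pt) (l : R) (A : set pt) (f : pt -> R) : \bar R :=
  (\int[@lebesgue_measure R]_(t in `[0%R, +oo[%classic)
      Hcontent beta a l [set x | A x /\ (t < f x)%R])%E.

Definition quasicontinuous (beta : R) (a : pt) (l : R) (f : pt -> R) : Prop :=
  forall eps : R, 0 < eps -> exists O : set pt,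
    open O /\ (Hcontent beta a l O < eps%:E)%E /\ {within ~` O, continuous f}.

Definition L1H (beta : R) (a : pt) (l : R) (f : pt -> R) : Prop :=
  quasicontinuous beta a l f /\
  (choquet beta a l (cube a l) (fun x => `|f x|%R) < +oo)%E.

Definition edist (x y : pt) : R := Num.sqrt (\sum_i (x ord0 i - y ord0 i) ^+ 2).
Definition ediam (E : set pt) : \bar R :=
  ereal_sup [set (edist x y)%:E | x in E & y in E].

(* beta-dimensional Hausdorff measure (without normalising constant) *)
Definition Hdelta (beta delta : R) (E : set pt) : \bar R :=
  ereal_inf [set s | exists F : nat -> set pt,
      E `<=` \bigcup_n F n /\ (forall n, (ediam (F n) <= delta%:E)%E) /\
      s = (\sum_(n <oo) (if F n == set0 then 0%E
                           else if ediam (F n) is r%:E then (r `^ beta)%:E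
                                else +oo%E))%E].
Definition Hmeasure (beta : R) (E : set pt) : \bar R :=
  ereal_sup [set Hdelta beta delta E | delta in [set delta : R | 0 < delta]].

End Defs.

(* Main.v *)
(* Calderon-Zygmund stopping time: the [Q_k] are the maximal dyadic subcubes of
   [Q] on which the average of [|f|] exceeds [lambda]; the parent of such a cube
   has average at most [lambda], which gives the factor [2 ^ beta].

   For (2), let [c > lambda], let [O] be an exceptional open set for [f], of
   content less than [eps], with a dyadic cover [(P_i)] of total size less than
   [eps], and put [theta = lambda / c]. A point outside [O] where [|f| > c] and
   all averages are at most [lambda] has, by continuity of [f] off [O], a dyadic
   neighbourhood [C] with [|f| > c] on [C \ O], so the content of [C \ O] is at
   most [theta * l(C) ^ beta]. Take the maximal dyadic cubes [C] with this
   property. Such a [C] is contained in some [P_i], or else the [P_i] meeting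
   [C] lie in [C]; in the latter case, since [C] itself has content [l(C) ^
   beta], these [P_i] have total size at least [(1 - theta) * l(C) ^ beta]. The
   maximal cubes are disjoint, so the bad set has content at most [eps * (1 + 1
   / (1 - theta))], hence zero, and sets of zero content are null for the
   Hausdorff measure. *)
Require Import Defs.
From HB Require Import structures.
From mathcomp Require Import all_boot all_order all_algebra.
From mathcomp Require Import all_classical all_reals all_analysis.
From mathcomp Require Import measurable_realfun.
From mathcomp Require Import ring lra zify.
Set Implicit Arguments.
Unset Strict Implicit.
Unset Printing Implicit Defensive.
Import Order.TTheory GRing.Theory Num.Theory.
Import numFieldNormedType.Exports.
Local Open Scope classical_set_scope.
Local Open Scope ring_scope.

(** * Dyadic cubes and stopping generations *)

Section DyadicCubes.
Context {R : realType} {d : nat}.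
Variables (a : 'rV[R]_d) (l : R).
Hypothesis l_gt0 : 0 < l.
Implicit Types (x y : 'rV[R]_d) (i j : int) (m : 'I_d -> int).

(** Index of the only cube of generation [j] around [x]; through [dcubeP], nesting and disjointness
    of cubes become equations between floors. *)
Definition didx j x : 'I_d -> int :=
  fun k : 'I_d => Num.floor ((x ord0 k - a ord0 k) / dside l j).

Lemma dside_gt0 j : 0 < dside l j.
Proof. by rewrite /dside mulr_gt0// exprz_gt0. Qed.

Lemma dsideD j (p : nat) : dside l j = 2 ^+ p * dside l (j + p%:Z).
Proof.
rewrite /dside mulrCA; congr (_ * _).
by rewrite opprD expfzDr ?pnatr_eq0// -exprnN mulrCA mulfV ?mulr1// expf_neq0// pnatr_eq0.
Qed.

Lemma dcubeP j m x : dcube a l j m x <-> m = didx j x.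
Proof.
have s0 := dside_gt0 j; split.
  move=> xm; apply/funext => i; have := xm i; rewrite !mxE => /andP[h1 h2].
  apply/esym/floor_def; rewrite intrD1 ler_pdivlMr// ltr_pdivrMr//.
  by apply/andP; split; lra.
move=> -> i; rewrite !mxE.
have /andP[] := floor_itv ((x ord0 i - a ord0 i) / dside l j).
rewrite intrD1 ler_pdivlMr// ltr_pdivrMr// /didx => h1 h2.
by apply/andP; split; lra.
Qed.

Lemma dcube_didx j x : dcube a l j (didx j x) x.
Proof. exact/dcubeP. Qed.

(** For an integer [k], [k <= floor w] iff [k * 2 ^+ p <= floor (2 ^+ p * w)]; so the fine floors
    determine the coarse ones. *)
Lemma didx_coarsen i j x y : i <= j -> didx j x = didx j y -> didx i x = didx i y.
Proof.
move=> ij xy.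
have [p jp] : exists p : nat, j = i + p%:Z by exists `|j - i|%N; lia.
subst j.
have key u v : Num.floor (u / dside l (i + p%:Z)) = Num.floor (v / dside l (i + p%:Z)) ->
    Num.floor (u / dside l i) <= Num.floor (v / dside l i).
  have scale w : w / dside l (i + p%:Z) = 2 ^+ p * (w / dside l i).
    by rewrite (dsideD i p); field; rewrite expf_neq0//= gt_eqF// dside_gt0.
  have p0 : (0 : R) < 2 ^+ p by rewrite exprn_gt0.
  have ge_scale (k : int) (w : R) : (k <= Num.floor w) = (k * 2 ^+ p <= Num.floor (2 ^+ p * w)).
    by rewrite !floor_ge_int rmorphM /= rmorphXn /= mulrC ler_pM2l.
  by rewrite !scale => uv; rewrite ge_scale -uv -ge_scale.
apply/funext => k; apply/eqP; rewrite eq_le.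
by rewrite /didx !key//; move/(congr1 (fun m => m k)) : xy.
Qed.

Lemma dcube_sub i j x : i <= j -> dcube a l j (didx j x) `<=` dcube a l i (didx i x).
Proof.
by move=> ij y /dcubeP xy; apply/dcubeP; exact: didx_coarsen xy.
Qed.

Lemma dcube0E x : cube a l x -> dcube a l 0 (didx 0 x) = cube a l.
Proof.
have s0 : dside l 0 = l by rewrite /dside oppr0 expr0z mulr1.
have c0 : dcube a l 0 (fun=> 0) = cube a l.
  by rewrite /dcube s0; congr cube; apply/rowP => i; rewrite !mxE mulr0 addr0.
by rewrite -{1}c0 => /dcubeP <-.
Qed.

Lemma dcube_corner j m : exists x, dcube a l j m x.
Proof.
exists (\row_i (a ord0 i + dside l j * (m i)%:~R)) => i.
by rewrite lexx ltrDl dside_gt0.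
Qed.

Lemma dside_small (e : R) : 0 < e -> exists n : nat, dside l n%:Z < e.
Proof.
move=> e0; exists (Num.truncn (l / e)).
set n := Num.truncn _.
have h : l / e < 2 ^+ n.
  apply: lt_le_trans (truncnS_gt _) _.
  by rewrite -natrX ler_nat; exact: ltn_expl.
by rewrite /dside -exprnN ltr_pdivrMr ?exprn_gt0// mulrC -ltr_pdivrMr.
Qed.

Section Stopping.
Variable G : int * ('I_d -> int) -> Prop.

(** Generations are natural numbers here, so only cubes of side at most [l] compete, and a largest
    one satisfying [G] exists as soon as there is any. *)
Definition first_at x (n : nat) :=
  G (n%:Z, didx n x) /\ forall p : nat, (p < n)%N -> ~ G (p%:Z, didx p x).

Lemma first_atP x (n : nat) : G (n%:Z, didx n x) ->
  exists2 p, (p <= n)%N & first_at x p.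
Proof.
elim/ltn_ind: n => n IH Gn.
have [[p [pn Gp]]|H] := pselect (exists p : nat, (p < n)%N /\ G (p%:Z, didx p x)).
  have [q qp xq] := IH _ pn Gp.
  by exists q => //; exact: leq_trans qp (ltnW pn).
by exists n => //; split=> // p pn Gp; apply: H; exists p.
Qed.

(** Points of one cube share all its ancestors. Together with [first_at_inj] this makes distinct
    maximal cubes disjoint. *)
Lemma first_at_sub x y (n : nat) :
  first_at x n -> dcube a l n (didx n x) y -> first_at y n.
Proof.
move=> [Gn Hn] /dcubeP xy; split; first by rewrite -xy.
by move=> p pn; rewrite -(@didx_coarsen p%:Z n%:Z x y _ xy) ?lez_nat 1?ltnW//; exact: Hn.
Qed.

Lemma first_at_inj x (n p : nat) : first_at x n -> first_at x p -> n = p.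
Proof.
move=> [Gn Hn] [Gp Hp]; case: (ltngtP n p) => //.
- by move=> /Hp /(_ Gn).
- by move=> /Hn /(_ Gp).
Qed.

End Stopping.

End DyadicCubes.

(** * Lower bound for the cost of covering a cube *)

Section CubeCover.
Context {R : realType} {d : nat}.
Implicit Types (a x : 'rV[R]_d) (b : nat -> 'rV[R]_d) (s : nat -> R).
Let mu := @lebesgue_measure R.

(* Integrates the covering inequality [1 <= \sum_n \1_(cube (b n) (s n))] in one
   coordinate after the other; [k] coordinates have been integrated out. *)
Lemma cube_cover_partial a (l : R) b s (k : nat) :
  (forall n, 0 <= s n) -> 0 <= l ->
  cube a l `<=` \bigcup_n cube (b n) (s n) ->
  (k <= d)%N -> forall x, cube a l x ->
  ((l ^+ k)%:E <= \sum_(n <oo) (s n ^+ k * \prod_(i < d | (k <= i)%N)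
      \1_(`[b n ord0 i, b n ord0 i + s n[%classic) (x ord0 i))%:E)%E.
Proof.
move=> s0 l0 cov; elim: k => [_ x ax|k IH kd x ax].
  have [n _ bx] := cov x ax.
  have h0 m : (0 <= (s m ^+ 0 * \prod_(i < d | (0 <= i)%N)
      \1_(`[b m ord0 i, b m ord0 i + s m[%classic) (x ord0 i))%:E)%E.
    by rewrite lee_fin expr0 mul1r prodr_ge0.
  apply: le_trans (nneseries_lim_ge (P := xpredT) n.+1 (fun m _ _ => h0 m)).
  rewrite big_nat_recr//=; apply: le_trans (leeDr _ _); last by rewrite sume_ge0.
  rewrite !expr0 mul1r lee_fin big1// => i _.
  by rewrite indicE mem_set//= in_itv/=; exact: bx.
pose i0 := Ordinal kd.
pose D : set R := `[a ord0 i0, a ord0 i0 + l[%classic.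
pose I n : set R := `[b n ord0 i0, b n ord0 i0 + s n[%classic.
pose c n := s n ^+ k * \prod_(i < d | (k.+1 <= i)%N)
      \1_(`[b n ord0 i, b n ord0 i + s n[%classic) (x ord0 i) : R.
have c0 n : 0 <= c n by rewrite mulr_ge0 ?exprn_ge0 ?prodr_ge0.
have mD : measurable D by exact: measurable_itv.
have mI n : measurable (I n) by exact: measurable_itv.
pose g n (t : R) : \bar R := ((c n)%:E * (\1_(I n) t)%:E)%E.
have mi n : measurable_fun D (EFin \o (\1_(I n) : R -> R)).
  by apply/measurable_EFinP; exact: measurable_indic.
have mf n : measurable_fun D (g n) by apply: measurable_funeM; exact: mi.
have f0 n t : (0 <= g n t)%E.
  by rewrite mule_ge0 ?lee_fin.
have pt t : D t -> ((l ^+ k)%:E <= \sum_(n <oo) g n t)%E.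
  (* The induction hypothesis is used at [x] with coordinate [k] replaced by [t]; only the factor
     for that coordinate depends on [t]. *)
  move=> Dt; pose y : 'rV[R]_d := \row_i (if i == i0 then t else x ord0 i).
  have ay : cube a l y.
    by move=> i; rewrite mxE; case: eqP => [->|_]; [move: Dt; rewrite /D/= in_itv|exact: ax].
  apply: le_trans (IH (ltnW kd) y ay) _.
  apply: lee_nneseries => n _; first by rewrite lee_fin mulr_ge0 ?exprn_ge0 ?prodr_ge0.
  rewrite /g -EFinM lee_fin (bigD1 i0)//= mxE eqxx mulrCA [leLHS]mulrC /c.
  rewrite ler_wpM2r// ler_wpM2l ?exprn_ge0// le_eqVlt; apply/orP; left; apply/eqP.
  apply: eq_big => [i|i /andP[_ /negbTE ii0]]; last by rewrite mxE ii0.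
  by rewrite ltn_neqAle -val_eqE /= eq_sym andbC.
have leI n : (mu (I n `&` D) <= (s n)%:E)%E.
  apply: (@le_trans _ _ (mu (I n))).
    apply: le_measure; [|rewrite inE; exact: mI|exact: subIsetl].
    by rewrite inE; exact: (measurableI (I n) D (mI n) mD).
  rewrite /mu lebesgue_measure_itv/= lte_fin; case: ifPn => _; last by rewrite lee_fin.
  by rewrite -EFinD lee_fin addrAC subrr add0r.
have muD : mu D = l%:E.
  rewrite /mu lebesgue_measure_itv/= lte_fin ltrDl.
  case: ltP => [lp|ln]; first by rewrite -EFinD addrAC subrr add0r.
  by congr EFin; apply/eqP; rewrite eq_le l0 ln.
have -> : (l ^+ k.+1)%:E = (\int[mu]_(t in D) cst (l ^+ k)%:E t)%E.
  by rewrite integral_cst// [X in (_ * X)%E](_ : _ = l%:E) -?EFinM ?exprSr.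
apply: (@le_trans _ _ (\int[mu]_(t in D) \sum_(n <oo) g n t)%E).
  apply: ge0_le_integral => //.
  - by move=> t _; rewrite lee_fin exprn_ge0.
  - by apply: ge0_emeasurable_sum => n; [move=> t _ _; exact: f0|move=> _; exact: mf].
rewrite integral_nneseries//.
apply: lee_nneseries => n _; first by move=> _; apply: integral_ge0.
rewrite ge0_integralZl_EFin//=; last exact: mi.
rewrite [X in (_ * X)%E](_ : _ = mu (I n `&` D)); last first.
  by apply: integral_indic; [exact: mD|exact: mI].
rewrite exprSr mulrAC -/(c n) [leRHS]EFinM.
by apply: lee_wpmul2l; [rewrite lee_fin|exact: leI].
Qed.

Lemma cube_cover_vol a (l : R) b s :
  (forall n, 0 <= s n) -> 0 < l ->
  cube a l `<=` \bigcup_n cube (b n) (s n) ->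
  ((l ^+ d)%:E <= \sum_(n <oo) (s n ^+ d)%:E)%E.
Proof.
move=> s0 l0 cov.
have aa : cube a l a by move=> i; rewrite lexx ltrDl.
apply: le_trans (cube_cover_partial s0 (ltW l0) cov (leqnn d) aa) _.
apply: lee_nneseries => n _; first by rewrite lee_fin mulr_ge0 ?exprn_ge0 ?prodr_ge0.
by rewrite big_pred0 ?mulr1// => i; rewrite leqNgt ltn_ord.
Qed.

(** A side above [l] pays alone. Otherwise all ratios [s n / l] are at most 1, so their power [d] is
    at most their power [beta], and the volume bound carries over. *)
Lemma cube_cover_powR (beta : R) a (l : R) b s :
  0 < beta -> beta <= d%:R -> (forall n, 0 <= s n) -> 0 < l ->
  cube a l `<=` \bigcup_n cube (b n) (s n) ->
  ((l `^ beta)%:E <= \sum_(n <oo) (s n `^ beta)%:E)%E.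
Proof.
move=> beta0 betad s0 l0 cov.
have p0 n : (0 <= (s n `^ beta)%:E)%E by rewrite lee_fin powR_ge0.
have [[n ln]|small] := pselect (exists n, l < s n).
  apply: le_trans (nneseries_lim_ge (P := xpredT) n.+1 (fun m _ _ => p0 m)).
  rewrite big_nat_recr//=; apply: le_trans (leeDr _ _); last by rewrite sume_ge0.
  by rewrite lee_fin ge0_ler_powR ?nnegrE ?(ltW beta0)// ltW.
have sl n : s n <= l by rewrite leNgt; apply/negP => ?; apply: small; exists n.
have h n : l `^ beta * l ^- d * s n ^+ d <= s n `^ beta.
  have -> : s n `^ beta = l `^ beta * (s n / l) `^ beta.
    by rewrite -powRM ?divr_ge0 ?(ltW l0)// mulrCA mulfV ?mulr1 ?gt_eqF.
  rewrite -mulrA ler_wpM2l ?powR_ge0// mulrC -expr_div_n.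
  (* Zero sides occur as padding; the left side then vanishes, because [0 < beta <= d] excludes
     [d = 0]. *)
  have [z|nz] := eqVneq (s n / l) 0.
    rewrite z powR0 ?gt_eqF// expr0n; case: eqP => // d0.
    by move: beta0; rewrite ltNge (le_trans betad)// d0.
  rewrite -powR_mulrn ?divr_ge0 ?(ltW l0)//.
  have pz : 0 < s n / l by rewrite lt0r nz divr_ge0// ltW.
  by apply: ger_powR => //; rewrite pz ler_pdivrMr// mul1r sl.
apply: (@le_trans _ _ ((l `^ beta * l ^- d)%:E * \sum_(n <oo) (s n ^+ d)%:E)%E).
  apply: (@le_trans _ _ ((l `^ beta * l ^- d)%:E * (l ^+ d)%:E)%E).
    by rewrite -EFinM lee_fin -mulrA mulVf ?mulr1// expf_neq0// gt_eqF.
  apply: lee_wpmul2l; last exact: cube_cover_vol cov.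
  by rewrite lee_fin mulr_ge0 ?powR_ge0// invr_ge0 exprn_ge0 ?ltW.
rewrite -nneseriesZl; last by move=> n _; rewrite lee_fin exprn_ge0.
apply: lee_nneseries => n _; last by rewrite -EFinM lee_fin h.
by move=> _; rewrite -EFinM lee_fin !mulr_ge0 ?powR_ge0 ?invr_ge0 ?exprn_ge0 ?(ltW l0).
Qed.

End CubeCover.

(** * Double series and measurability of monotone functions *)

Section Series.
Context {R : realType}.
Local Open Scope ereal_scope.

Lemma nat_pairing : exists e : nat -> nat * nat, set_bij [set: nat] [set: nat * nat] e.
Proof. by apply/card_set_bijP; rewrite card_eq_sym; exact: card_nat2. Qed.

(** Serves to merge a sequence of covers into one; nonnegative terms may be summed in any order. *)
Lemma nneseries_pairing (u : nat -> nat -> \bar R) (e : nat -> nat * nat) :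
  set_bij [set: nat] [set: nat * nat] e -> (forall i j, 0 <= u i j) ->
  \sum_(k <oo) u (e k).1 (e k).2 = \sum_(i <oo) \sum_(j <oo) u i j.
Proof.
move=> be u0; rewrite nneseries_esumT// nneseries_esumT; last first.
  by move=> i; exact: nneseries_ge0.
under [RHS]eq_esum do rewrite nneseries_esumT//.
rewrite esum_esum// (@reindex_esum _ _ _ [set: nat] _ e)//.
rewrite (_ : _ `*`` _ = [set: nat * nat])//.
by apply/seteqP; split=> [|[i j]].
Qed.

(** Preimages of upper rays are intervals. This makes the integrand of [choquet] measurable. *)
Lemma nonincreasing_measurable (D : set R) (g : R -> \bar R) :
  measurable D -> (forall s t : R, (s <= t)%R -> g t <= g s) -> measurable_fun D g.
Proof.
move=> mD ag.
apply: (measurability _ (ErealGenOInfty.measurableE R)) => // _ [_ [x ->] <-].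
apply: measurableI => //; apply: is_interval_measurable => s t /=.
rewrite !in_itv/= !andbT => xs xt z /andP[_ zt].
by rewrite in_itv/= andbT; exact: lt_le_trans xt (ag _ _ zt).
Qed.

End Series.

(** * Covers made of two families *)

Section TwoCovers.
Context {R : realType} {d : nat}.
Implicit Types (b : nat -> 'rV[R]_d) (s : nat -> R).

(** Meant for a cube whose parts inside and outside an exceptional set are covered separately. *)
Lemma cube_cover_powR2 (beta : R) (a : 'rV[R]_d) (l : R) b s b' s' :
  0 < beta -> beta <= d%:R -> 0 < l ->
  (forall n, 0 <= s n) -> (forall n, 0 <= s' n) ->
  cube a l `<=` \bigcup_n cube (b n) (s n) `|` \bigcup_n cube (b' n) (s' n) ->
  ((l `^ beta)%:E <= \sum_(n <oo) (s n `^ beta)%:E + \sum_(n <oo) (s' n `^ beta)%:E)%E.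
Proof.
move=> beta0 betad l0 s0 s'0 cov.
have [e be] := nat_pairing.
(* The two covers are padded with empty cubes of side 0. *)
pose B i j := match i with 0%N => b j | 1%N => b' j | _ => a end.
pose S i j := match i with 0%N => s j | 1%N => s' j | _ => 0 end.
have S0 i j : 0 <= S i j by case: i => [|[|i]] /=.
have BS x i j : cube (B i j) (S i j) x -> exists k,
    cube (B (e k).1 (e k).2) (S (e k).1 (e k).2) x.
  by move=> H; have [_ _ /(_ (i, j) I)[k _ ek]] := be; exists k; rewrite ek.
have := @cube_cover_powR R d beta a l (fun k => B (e k).1 (e k).2) (fun k => S (e k).1 (e k).2)
  beta0 betad (fun k => S0 _ _) l0.
rewrite (nneseries_pairing (u := fun i j => (S i j `^ beta)%:E) be); last first.
  by move=> i j; rewrite lee_fin powR_ge0.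
rewrite (@nneseries_split _ _ 0 2)//; last first.
  by move=> k _; apply: nneseries_ge0 => n _ _; rewrite lee_fin powR_ge0.
rewrite add0n big_nat_recr// big_nat1/= [X in (_ + X)%E](_ : _ = 0%E); last first.
  apply: eseries0 => -[|[|i]]// _ _; apply: eseries0 => j _ _.
  by rewrite /S powR0// gt_eqF.
rewrite adde0; apply => x /cov[] [n _ xn].
- by have [k xk] := BS x 0%N n xn; exists k.
- by have [k xk] := BS x 1%N n xn; exists k.
Qed.

End TwoCovers.

(** * Dyadic content and Choquet integral *)

Section Content.
Context {R : realType} {d : nat}.
Variables (beta : R) (a : 'rV[R]_d) (l : R).
Implicit Types (A B E : set 'rV[R]_d) (f : 'rV[R]_d -> R).
Local Open Scope ereal_scope.

Lemma Hcontent_ge0 E : 0 <= Hcontent beta a l E.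
Proof.
apply: le_ereal_inf_tmp => _ [j [m [_ ->]]].
by apply: nneseries_ge0 => n _ _; rewrite lee_fin powR_ge0.
Qed.

Lemma le_Hcontent A B : A `<=` B -> Hcontent beta a l A <= Hcontent beta a l B.
Proof.
move=> AB; apply: le_ereal_inf => s [j [m [cov ->]]].
by exists j, m; split=> //; exact: subset_trans cov.
Qed.

Lemma Hcontent_le_cover E j m : E `<=` \bigcup_n dcube a l (j n) (m n) ->
  Hcontent beta a l E <= \sum_(n <oo) (dside l (j n) `^ beta)%:E.
Proof. by move=> cov; apply: ereal_inf_lbound; exists j, m. Qed.

Lemma Hcontent_lt_cover E x : Hcontent beta a l E < x -> exists j m,
  E `<=` \bigcup_n dcube a l (j n) (m n) /\ \sum_(n <oo) (dside l (j n) `^ beta)%:E < x.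
Proof. by move=> /ereal_inf_lt[_ [j [m [cov ->]]] lt]; exists j, m. Qed.

(** Covers of the [E n] of cost below [eps / 2 ^ n.+1] are merged into one. *)
Lemma Hcontent_bigcup0 (E : nat -> set 'rV[R]_d) :
  (forall n, Hcontent beta a l (E n) = 0) -> Hcontent beta a l (\bigcup_n E n) = 0.
Proof.
move=> E0; apply/eqP; rewrite eq_le Hcontent_ge0 andbT.
apply/lee_addgt0Pr => eps eps0; rewrite add0e.
have ch n : exists jm : (nat -> int) * (nat -> 'I_d -> int),
    E n `<=` \bigcup_i dcube a l (jm.1 i) (jm.2 i) /\
    \sum_(i <oo) (dside l (jm.1 i) `^ beta)%:E < (eps / (2 ^ n.+1)%:R)%:E.
  have [|j [m jm]] := @Hcontent_lt_cover (E n) (eps / (2 ^ n.+1)%:R)%:E.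
    by rewrite E0 lte_fin divr_gt0// ltr0n expn_gt0.
  by exists (j, m).
have /choice[jm jmP] := ch.
have [e be] := nat_pairing.
apply: (@le_trans _ _ (\sum_(k <oo) (dside l ((jm (e k).1).1 (e k).2) `^ beta)%:E)).
  apply: (@Hcontent_le_cover _ _ (fun k => (jm (e k).1).2 (e k).2)) => x [n _ Enx].
  have [i _ xi] := (jmP n).1 x Enx.
  have [_ _ /(_ (n, i) I)[k _ ek]] := be.
  by exists k => //; rewrite ek.
rewrite (nneseries_pairing (u := fun n i => (dside l ((jm n).1 i) `^ beta)%:E) be); last first.
  by move=> n i; rewrite lee_fin powR_ge0.
apply: le_trans (epsilon_trick0 xpredT (ltW eps0)).
apply: lee_nneseries => n _; last exact: ltW (jmP n).2.
by move=> _; apply: nneseries_ge0 => i _ _; rewrite lee_fin powR_ge0.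
Qed.

Lemma measurable_Hcontent_superlevel A f (D : set R) : measurable D ->
  measurable_fun D (fun t => Hcontent beta a l [set x | A x /\ (t < f x)%R]).
Proof.
move=> mD; apply: nonincreasing_measurable => // s t st.
by apply: le_Hcontent => x [Ax tf]; split=> //; exact: le_lt_trans st tf.
Qed.

Lemma le_choquet A B f : A `<=` B -> choquet beta a l A f <= choquet beta a l B f.
Proof.
move=> AB; apply: ge0_le_integral => //.
- by move=> t _; exact: Hcontent_ge0.
- exact: measurable_Hcontent_superlevel.
- exact: measurable_Hcontent_superlevel.
- by move=> t _; apply: le_Hcontent => x [Ax tf]; split=> //; exact: AB.
Qed.

(** Chebyshev's inequality: for every [t] in [[0, c[] the superlevel set at [t] contains [B]. *)
Lemma choquet_ge A B f (c : R) : (0 <= c)%R ->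
  (forall x, B x -> A x /\ (c < f x)%R) ->
  c%:E * Hcontent beta a l B <= choquet beta a l A f.
Proof.
move=> c0 cf; set D : set R := `[0%R, +oo[%classic.
pose D' : set R := `[0%R, c[%classic.
have mD' : measurable D' by exact: measurable_itv.
have muD' : lebesgue_measure D' = c%:E.
  rewrite lebesgue_measure_itv/= lte_fin; case: ltP => [cp|cn]; first by rewrite oppr0 adde0.
  by congr EFin; apply/eqP; rewrite eq_le c0 cn.
have -> : c%:E * Hcontent beta a l B =
    \int[@lebesgue_measure R]_(t in D') cst (Hcontent beta a l B) t.
  rewrite integral_cst// muleC; congr (_ * _).
  by rewrite -muD'.
apply: (@le_trans _ _ (\int[@lebesgue_measure R]_(t in D')
    Hcontent beta a l [set x | A x /\ (t < f x)%R])).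
  apply: ge0_le_integral => //.
  - by move=> t _; exact: Hcontent_ge0.
  - exact: measurable_Hcontent_superlevel.
  - move=> t; rewrite /D'/= in_itv/= => /andP[_ tc].
    by apply: le_Hcontent => x /cf[Ax fx]; split=> //; exact: lt_trans fx.
apply: ge0_subset_integral => //.
- by apply: measurable_Hcontent_superlevel; exact: measurable_itv.
- by move=> t _; exact: Hcontent_ge0.
- by move=> t; rewrite /D'/= !in_itv/= andbT => /andP[].
Qed.

End Content.

(** * Zero content implies zero Hausdorff measure *)

Section Diameter.
Context {R : realType} {d : nat}.
Variables (beta : R) (a : 'rV[R]_d) (l : R).
Hypotheses (beta_gt0 : 0 < beta) (l_gt0 : 0 < l).

(** The factor [d.+1] is a crude bound for the square root of [d]. The bound [0 <= r] rests on the
    cube being nonempty, since an empty supremum is [-oo]. *)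
Lemma ediam_dcube (j : int) (m : 'I_d -> int) :
  exists r, [/\ ediam (dcube a l j m) = r%:E, 0 <= r & r <= d.+1%:R * dside l j].
Proof.
have s0 := dside_gt0 l_gt0 j.
have [x xm] := dcube_corner a l_gt0 j m.
have ub : (ediam (dcube a l j m) <= (d.+1%:R * dside l j)%:E)%E.
  apply: ge_ereal_sup => _ [u um [v vm <-]]; rewrite lee_fin /Defs.edist.
  have -> : d.+1%:R * dside l j = Num.sqrt ((d.+1%:R * dside l j) ^+ 2).
    by rewrite sqrtr_sqr ger0_norm// mulr_ge0 ?(ltW s0).
  rewrite ler_wsqrtr//.
  apply: (@le_trans _ _ (\sum_(i < d) dside l j ^+ 2)).
    apply: ler_sum => i _; rewrite -real_normK ?num_real// lerXn2r ?nnegrE ?(ltW s0)//.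
    have := um i; have := vm i; rewrite ler_norml => /andP[? ?] /andP[? ?].
    by apply/andP; split; lra.
  rewrite sumr_const card_ord [leRHS]exprMn -[_ *+ d]mulr_natl ler_wpM2r ?exprn_ge0 ?(ltW s0)//.
  by rewrite -natrX ler_nat (leq_trans (leqnSn d))// expnS expn1 leq_pmulr.
have lb : (0 <= ediam (dcube a l j m))%E.
  have : ((Defs.edist x x)%:E <= ediam (dcube a l j m))%E.
    by apply: ereal_sup_ubound; exists x => //; exists x.
  by apply: le_trans; rewrite lee_fin sqrtr_ge0.
case E : (ediam _) ub lb => [r| |]//; rewrite !lee_fin => ub lb.
by exists r.
Qed.

Lemma Hmeasure_ge0 (E : set 'rV[R]_d) : (0 <= Hmeasure beta E)%E.
Proof.
apply: (@le_trans _ _ (Hdelta beta 1 E)); last first.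
  by apply: ereal_sup_ubound; exists 1 => //=.
apply: le_ereal_inf_tmp => _ [F [_ [_ ->]]].
apply: nneseries_ge0 => n _ _; case: ifP => // _.
by case: ediam => //= r; rewrite lee_fin powR_ge0.
Qed.

Lemma Hmeasure_eq0 (E : set 'rV[R]_d) : Hcontent beta a l E = 0%E -> Hmeasure beta E = 0%E.
Proof.
move=> E0; apply/eqP; rewrite eq_le Hmeasure_ge0 andbT.
apply: ge_ereal_sup => _ [delta /= delta0 <-].
apply/lee_addgt0Pr => eta eta0; rewrite add0e.
pose M : R := d.+1%:R; have M0 : 0 < M by rewrite ltr0n.
(* The first entry keeps each covering cube of diameter at most [delta], the second keeps the sum of
   the powers of the diameters at most [eta]. *)
pose eps : R := Num.min ((delta / M) `^ beta) (eta / M `^ beta).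
have eps0 : 0 < eps by rewrite lt_min powR_gt0 ?divr_gt0// powR_gt0.
have [|j [m [cov lt]]] := @Hcontent_lt_cover R d beta a l E eps%:E.
  by rewrite E0 lte_fin.
have s0 n := dside_gt0 l_gt0 (j n).
have p0 n : (0 <= (dside l (j n) `^ beta)%:E)%E by rewrite lee_fin powR_ge0.
have small n : M * dside l (j n) <= delta.
  rewrite mulrC -ler_pdivlMr// leNgt; apply/negP => sn.
  have : ((dside l (j n) `^ beta)%:E < eps%:E)%E.
    apply: le_lt_trans lt.
    apply: le_trans (nneseries_lim_ge (P := xpredT) n.+1 (fun m _ _ => p0 m)).
    by rewrite big_nat_recr//=; apply: le_trans (leeDr _ _); last by rewrite sume_ge0.
  rewrite lte_fin ltNge => /negP; apply; apply: (@le_trans _ _ ((delta / M) `^ beta)).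
    by rewrite /eps ge_min lexx.
  by rewrite ge0_ler_powR ?nnegrE ?divr_ge0 ?ltW.
pose F n := dcube a l (j n) (m n).
apply: (@le_trans _ _ (\sum_(n <oo) (if F n == set0 then 0%E
                           else if ediam (F n) is r%:E then (r `^ beta)%:E
                                else +oo))%E).
  apply: ereal_inf_lbound; exists F; split=> //; split=> // n.
  have [r [-> _ rM]] := ediam_dcube (j n) (m n).
  by rewrite lee_fin (le_trans rM)// small.
apply: (@le_trans _ _ (\sum_(n <oo) ((M `^ beta)%:E * (dside l (j n) `^ beta)%:E))%E).
  apply: lee_nneseries => n _.
    by move=> _; case: ifP => // _; case: ediam => //= r; rewrite lee_fin powR_ge0.
  have [r [-> r0 rM]] := ediam_dcube (j n) (m n).
  rewrite -EFinM -powRM ?(ltW M0) ?(ltW (s0 n))//.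
  case: ifP => _; rewrite lee_fin ?powR_ge0//.
  apply: ge0_ler_powR; rewrite ?nnegrE//; first exact: ltW.
  by rewrite mulr_ge0// ltW.
rewrite nneseriesZl//.
apply: (@le_trans _ _ ((M `^ beta)%:E * eps%:E)%E).
  by apply: lee_wpmul2l; [rewrite lee_fin powR_ge0|exact: ltW].
rewrite -EFinM lee_fin mulrC -ler_pdivlMr ?powR_gt0//.
by rewrite /eps ge_min lexx orbT.
Qed.

End Diameter.

(** * A charging argument *)

Section Dedup.
Context {R : realType}.
Local Open Scope ereal_scope.

(* All the weights [w k] with the same value [K k] pay for that value, which must
   then be counted only once: [K'] keeps its first occurrence. *)
Lemma charge_first_occurrence (T : Type) (K : nat -> option T)
    (w : nat -> \bar R) (V : T -> \bar R) (C : R) :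
  (0 <= C)%R -> (forall i, 0 <= w i) -> (forall t, 0 <= V t) ->
  (forall i t, K i = Some t ->
     V t <= C%:E * \sum_(k <oo) (if `[< K k = Some t >] then w k else 0)) ->
  exists K' : nat -> option T,
    [/\ forall i t, K i = Some t -> exists i', K' i' = Some t,
        forall i t, K' i = Some t -> K i = Some t &
        \sum_(i <oo) (if K' i is Some t then V t else 0) <= C%:E * \sum_(k <oo) w k].
Proof.
move=> C0 w0 V0 VK.
pose first i := forall k, (k < i)%N -> K k <> K i.
pose K' i := if `[< first i >] then K i else None.
have K'P i t : K' i = Some t -> first i /\ K i = Some t.
  by rewrite /K'; case: asboolP.
exists K'; split.
- move=> i t; elim/ltn_ind: i => i IH Ki.
  have [fi|] := pselect (first i); first by exists i; rewrite /K' asboolT.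
  rewrite /first -existsNP => -[k].
  by rewrite not_implyP => -[ki] /contrapT Kk; apply: IH ki _; rewrite Kk.
- by move=> i t /K'P[].
(* [r i k] is the share of [w k] charged to the value kept at [i]. For fixed [k] at most one [i] has
   a nonzero share, as it must be the first occurrence of [K k]. *)
pose r i k := if K' i is Some t then (if `[< K k = Some t >] then w k else 0) else 0.
have r0 i k : 0 <= r i k by rewrite /r; case: (K' i) => // t; case: ifP.
apply: (@le_trans _ _ (\sum_(i <oo) C%:E * \sum_(k <oo) r i k)).
  apply: lee_nneseries => i _; first by case: (K' i).
  rewrite /r; case E: (K' i) => [t|].
    by apply: (VK i); have [] := K'P _ _ E.
  by rewrite mule_ge0//; apply: nneseries_ge0.
rewrite nneseriesZl; last by move=> i _; exact: nneseries_ge0.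
apply: lee_wpmul2l; first by rewrite lee_fin.
rewrite nneseries_interchange//; apply: lee_nneseries => k _.
  by move=> _; exact: nneseries_ge0.
have rP i : r i k != 0 -> [/\ first i, K i = K k & r i k = w k].
  rewrite /r; case E: (K' i) => [t|]; last by rewrite eqxx.
  have [fi Ki] := K'P _ _ E.
  by case: asboolP; rewrite ?eqxx// => Kk _; rewrite Ki Kk.
have [[i0 ri0]|none] := pselect (exists i, r i k != 0); last first.
  rewrite eseries0// => i _ _; apply/eqP/negPn/negP => ri.
  by apply: none; exists i.
have [f0 K0 rw] := rP _ ri0.
rewrite (nneseriesD1 (n := i0))// eseries0 ?adde0 ?rw//.
move=> i _ /= ii0; apply/eqP/negPn/negP => /rP[fi Ki _].
move: ii0; case: (ltngtP i i0) => // lti _.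
- by apply: (f0 _ lti); rewrite Ki.
- by apply: (fi _ lti); rewrite Ki.
Qed.

End Dedup.

(** * Content of the bad set *)

Section Differentiation.
Context {R : realType} {d : nat}.
Variables (beta : R) (a : 'rV[R]_d) (l : R) (f : 'rV[R]_d -> R).
Hypotheses (beta_gt0 : 0 < beta) (beta_le_d : beta <= d%:R) (l_gt0 : 0 < l).

(** Relative continuity gives a ball of the sup norm, and a dyadic cube around [x] of side below its
    radius fits in it. *)
Lemma superlevel_dcube (O : set 'rV[R]_d) (c : R) (x : 'rV[R]_d) :
  {within ~` O, continuous f} -> ~ O x -> c < `|f x| ->
  exists n : nat, forall y, dcube a l n (didx a l n x) y -> ~ O y -> c < `|f y|.
Proof.
move=> cf Ox cx.
have : \forall y \near within (~` O) (nbhs x), c < `|f y|.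
  rewrite nbhs_subspace_in//.
  have h : (`|f y| @[y --> (x : subspace (~` O))]) --> `|f x| by apply: cvg_norm; exact: cf.
  exact: (cvgr_gt _ h).
rewrite /within/= => /nbhs_ballP[e /= e0 he].
have [n ne] := dside_small l e0.
exists n => y xy Oy; apply: he => //; split=> // i k.
rewrite (ord1 i) /ball/=.
have := dcube_didx a l_gt0 n x k; have := xy k => /andP[? ?] /andP[? ?].
by rewrite ltr_norml; apply/andP; split; lra.
Qed.

(** A cover of [E] arises from the cover [P_i] of [O] by enlarging some [P_i] to maximal good cubes.
    Counted once each, these cost at most [eps / (1 - theta)]; the other [P_i] cost at most
    [eps]. *)
Lemma Hcontent_le_exceptional (E O : set 'rV[R]_d) (theta eps : R) :
  0 <= theta < 1 -> 0 < eps -> (Hcontent beta a l O < eps%:E)%E ->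
  (forall x, E x -> ~ O x -> exists n : nat,
     (Hcontent beta a l (dcube a l n (didx a l n x) `\` O) <=
        (theta * dside l n `^ beta)%:E)%E) ->
  (Hcontent beta a l E <= (eps * (1 + (1 - theta)^-1))%:E)%E.
Proof.
move=> /andP[theta0 theta1] eps0 Oeps Egood.
have [j [m [Ocov Psum]]] := Hcontent_lt_cover Oeps.
have /choice[p pP] : forall i, exists x, dcube a l (j i) (m i) x.
  by move=> i; exact: dcube_corner.
have mE i : m i = didx a l (j i) (p i) by apply/dcubeP.
pose w i : \bar R := (dside l (j i) `^ beta)%:E.
have w0 i : (0 <= w i)%E by rewrite lee_fin powR_ge0.
pose good (k : int * ('I_d -> int)) : Prop :=
  (Hcontent beta a l (dcube a l k.1 k.2 `\` O) <= (theta * dside l k.1 `^ beta)%:E)%E.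
(* [free n x]: the level-[n] cube around [x] is not strictly inside a [P_k]. *)
pose free (n : nat) x := forall k y, dcube a l n (didx a l n x) y ->
  dcube a l (j k) (m k) y -> n%:Z <= j k.
have free_sub n x y : free n x -> dcube a l n (didx a l n x) y -> free n y.
  by move=> fx /(dcubeP a l_gt0) xy; rewrite /free -xy.
pose T i n := first_at a l good (p i) n /\ free n (p i).
(* [K i] is the maximal good cube around [p i], recorded only if no [P_k] strictly contains it.
   Freeness applied to [P_i] itself shows that this cube contains [P_i]. *)
pose K i := if pselect (exists n, T i n) is left H
  then let n := projT1 (cid H) in Some (n%:Z, didx a l n (p i)) else None.
have KT i n : T i n -> K i = Some (n%:Z, didx a l n (p i)).
  move=> Tin; rewrite /K; case: pselect => [H|]; last by case; exists n.
  case: cid => n' /= Tin'.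
  by rewrite (first_at_inj Tin.1 Tin'.1).
have KP i t : K i = Some t -> exists2 n, T i n & t = (n%:Z, didx a l n (p i)).
  rewrite /K; case: pselect => // H; case: cid => n Tin /= [<-].
  by exists n.
(* The part of the cube off [O] has content at most [theta] times its size. The [P_k] meeting the
   cube lie in it by freeness, hence are charged to it, and must pay for the rest. *)
have dense x n : first_at a l good x n -> free n x ->
    ((dside l n `^ beta)%:E <= ((1 - theta)^-1)%:E *
      \sum_(k <oo) (if `[< K k = Some (n%:Z, didx a l n x) >] then w k else 0))%E.
  move=> fx free_x; set C := dcube a l n (didx a l n x).
  set t := (n%:Z, didx a l n x); set S := (\sum_(k <oo) _)%E.
  have S0 : (0 <= S)%E by apply: nneseries_ge0 => k _ _; case: ifP.
  have gx : good t := fx.1.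
  have H : ((dside l n `^ beta)%:E <= (theta * dside l n `^ beta)%:E + S)%E.
    apply/lee_addgt0Pr => eta eta0.
    have [|r [q [qcov qlt]]] := @Hcontent_lt_cover R d beta a l (C `\` O)
        ((theta * dside l n `^ beta)%:E + eta%:E)%E.
      by apply: le_lt_trans gx _; rewrite lteDl// lte_fin.
    have := @cube_cover_powR2 R d beta (\row_i (a ord0 i + dside l n * (didx a l n x i)%:~R))
      (dside l n)
      (fun k => \row_i (a ord0 i + dside l (r k) * (q k i)%:~R)) (fun k => dside l (r k))
      (fun k => \row_i (a ord0 i + dside l (j k) * (m k i)%:~R))
      (fun k => if `[< K k = Some t >] then dside l (j k) else 0) beta_gt0 beta_le_d.
    (* The [P_k] not charged to [t] were given side 0, whose power is 0 because [beta] is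
       positive. *)
    have -> : (\sum_(k <oo)
        ((if `[< K k = Some t >] then dside l (j k) else 0) `^ beta)%:E = S)%E.
      by apply: eq_eseriesr => k _; case: ifP => // _; rewrite powR0 ?gt_eqF.
    move=> H; apply: le_trans (H _ _ _ _) _.
    - exact: dside_gt0.
    - by move=> k; rewrite ltW ?dside_gt0.
    - by move=> k; case: ifP => // _; rewrite ltW ?dside_gt0.
    - move=> y Cy; have [Oy|Oy] := pselect (O y); last first.
        by left; have [k _ ky] := qcov y (conj Cy Oy); exists k.
      right; have [k _ ky] := Ocov y Oy; exists k => //.
      have nj := free_x k y Cy ky.
      have xy : didx a l n x = didx a l n y by apply/dcubeP.
      have py : didx a l n (p k) = didx a l n y.
        by apply: (didx_coarsen l_gt0 nj); rewrite -mE; apply/dcubeP.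
      have Cp : C (p k) by apply/(dcubeP a l_gt0); rewrite xy py.
      rewrite asboolT//; last first.
        rewrite (@KT k n) /t ?xy ?py//; split; first exact: first_at_sub fx Cp.
        exact: free_sub free_x Cp.
    - rewrite addeAC; apply: leeD => //; exact: ltW.
  have t1 : 0 < 1 - theta by rewrite subr_gt0.
  rewrite lee_pdivlMl//.
  case: (S) S0 H => [s|_ _|//]; last by rewrite leey.
  by rewrite -!EFinM -EFinD !lee_fin => s0 H; lra.
have [K' [KK' K'K K'sum]] : exists K' : nat -> option (int * ('I_d -> int)),
    [/\ forall i t, K i = Some t -> exists i', K' i' = Some t,
        forall i t, K' i = Some t -> K i = Some t &
        (\sum_(i <oo) (if K' i is Some t then (dside l t.1 `^ beta)%:E else 0) <=
          ((1 - theta)^-1)%:E * \sum_(k <oo) w k)%E].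
  apply: (@charge_first_occurrence _ _ K w (fun t => (dside l t.1 `^ beta)%:E)) => //.
  - by rewrite invr_ge0 subr_ge0 ltW.
  - by move=> t; rewrite lee_fin powR_ge0.
  - by move=> i t /KP[n [fi free_i] ->]; exact: dense.
(* A repeated charge falls back to [P_i], so the size of [C i] is at most [w i] plus the charge kept
   at [i]. *)
pose C i := if K' i is Some t then t else (j i, m i).
apply: (@le_trans _ _ (\sum_(i <oo) (dside l (C i).1 `^ beta)%:E)%E); last first.
  apply: (@le_trans _ _ (\sum_(i <oo) (w i +
      (if K' i is Some t then (dside l t.1 `^ beta)%:E else 0)))%E).
    apply: lee_nneseries => i _; first by rewrite lee_fin powR_ge0.
    rewrite /C; case: (K' i) => [t|]; last by rewrite adde0.
    by rewrite leeDr.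
  rewrite nneseriesD//; last by move=> i _ _; case: (K' i) => // t; rewrite lee_fin powR_ge0.
  rewrite mulrDr mulr1 EFinD; apply: leeD; first exact: ltW.
  apply: le_trans K'sum _; rewrite mulrC EFinM.
  apply: lee_wpmul2l; first by rewrite lee_fin invr_ge0 subr_ge0 ltW.
  exact: ltW.
apply: (@Hcontent_le_cover _ _ _ _ _ _ _ (fun i => (C i).2)).
have Pcov k x : dcube a l (j k) (m k) x -> (\bigcup_i dcube a l (C i).1 (C i).2) x.
  move=> kx; exists k => //; rewrite /C; case EK : (K' k) => [t|]//.
  have [n [_ free_n] ->] := KP _ _ (K'K _ _ EK).
  have nj := free_n k (p k) (dcube_didx a l_gt0 _ _) (pP k).
  by apply: (dcube_sub l_gt0 nj); rewrite -mE.
move=> x Ex; have [Ox|Ox] := pselect (O x).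
  by have [k _ kx] := Ocov x Ox; exact: Pcov kx.
have [n0 gx] := Egood x Ex Ox.
have [n _ fx] := @first_atP R d a l good x n0 gx.
have [free_x|] := pselect (free n x); last first.
  (* Some [P_k] meeting the maximal cube has a smaller generation, so it contains that cube and
     [x]. *)
  rewrite /free -existsNP => -[k]; rewrite -existsNP => -[y].
  move=> /not_implyP[xy] /not_implyP[ky] /negP; rewrite -ltNge => jn.
  apply: (Pcov k); move/(dcubeP a l_gt0): ky => ->.
  apply/(dcubeP a l_gt0); apply: (didx_coarsen l_gt0 (ltW jn)).
  by apply/esym/(dcubeP a l_gt0).
have [[k Kk]|none] := pselect (exists k, K k = Some (n%:Z, didx a l n x)).
  have [i K'i] := KK' _ _ Kk.
  by exists i => //; rewrite /C K'i; exact: dcube_didx.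
(* A free maximal cube to which nothing is charged would have size at most 0 by [dense]. *)
have := dense x n fx free_x; rewrite eseries0; last first.
  by move=> k _ _; rewrite asboolF// => Kk; apply: none; exists k.
by rewrite mule0 lee_fin leNgt powR_gt0// dside_gt0.
Qed.

(** By Chebyshev's inequality, a cube of average at most [lambda] with [c < |f|] off the exceptional
    set is good for [theta = lambda / c]. *)
Lemma superlevel_null (lambda c : R) :
  0 < lambda -> lambda < c -> quasicontinuous beta a l f ->
  Hcontent beta a l [set x | (forall n : nat,
      (choquet beta a l (dcube a l n (didx a l n x)) (fun y => `|f y|%R) <=
       (lambda * dside l n `^ beta)%:E)%E) /\ c < `|f x|] = 0%E.
Proof.
move=> lambda0 lc qf; apply/eqP; rewrite eq_le Hcontent_ge0 andbT.
have c0 : 0 < c := lt_trans lambda0 lc.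
have t1 : 0 < 1 - lambda / c by rewrite subr_gt0 ltr_pdivrMr// mul1r.
apply/lee_addgt0Pr => eta eta0; rewrite add0e.
have M0 : 0 < 1 + (1 - lambda / c)^-1 by rewrite addr_gt0// invr_gt0.
(* With this [eps] the bound of [Hcontent_le_exceptional] is exactly [eta]. *)
have eps0 : 0 < eta / (1 + (1 - lambda / c)^-1) by rewrite divr_gt0.
have [U [_ [Oeps cf]]] := qf _ eps0.
rewrite -[eta](@divfK _ (1 + (1 - lambda / c)^-1)) ?gt_eqF//.
apply: Hcontent_le_exceptional Oeps _ => //.
  by rewrite divr_ge0 ?(ltW lambda0) ?(ltW c0)// -subr_gt0.
move=> x [avg cx] Ox.
have [n hn] := superlevel_dcube cf Ox cx.
exists n; rewrite mulrAC [X in (_ <= X)%E]EFinM lee_pdivlMr// muleC.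
apply: le_trans (avg n); apply: choquet_ge; first exact: ltW.
by move=> y [xy Oy]; split=> //; exact: hn.
Qed.

End Differentiation.

(** * The selected cubes *)

Lemma countable_fun_ord (d : nat) (K : set (int * ('I_d -> int))) : countable K.
Proof.
(* The domain of [g] is a countable type, and by extensionality [g] reaches every pair. *)
pose g (u : int * {ffun 'I_d -> int}) : int * ('I_d -> int) := (u.1, u.2 : 'I_d -> int).
apply: (@sub_countable _ _ _ (range g)); last first.
  by apply: sub_countable (card_image_le _ _) _; exact: countableP.
apply: subset_card_le => -[n m] _; exists (n, [ffun i => m i]) => //.
by rewrite /g; congr pair; apply/funext => i; rewrite ffunE.
Qed.

Theorem theorem3p4 (R : realType) (d : nat) (beta : R) (a : 'rV[R]_d) (l : R)
    (f : 'rV[R]_d -> R) (lambda : R) :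
  0 < beta -> beta <= d%:R -> 0 < l ->
  L1H beta a l f ->
  0 < lambda ->
  (((l `^ beta)^-1)%:E * choquet beta a l (cube a l) (fun x => `|f x|%R)
     <= lambda%:E)%E ->
  exists K : set (int * ('I_d -> int)),
    countable K /\
    (forall k, K k -> dcube a l k.1 k.2 `<=` cube a l) /\
    (forall k k', K k -> K k' -> k <> k' ->
       dcube a l k.1 k.2 `&` dcube a l k'.1 k'.2 = set0) /\
    (forall k, K k ->
       (lambda%:E < ((dside l k.1 `^ beta)^-1)%:E *
                    choquet beta a l (dcube a l k.1 k.2) (fun x => `|f x|%R))%E /\
       (((dside l k.1 `^ beta)^-1)%:E *
          choquet beta a l (dcube a l k.1 k.2) (fun x => `|f x|%R)
        <= (2%:R `^ beta * lambda)%:E)%E) /\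
    Hmeasure beta [set x | cube a l x /\
                     ~ (exists k, K k /\ dcube a l k.1 k.2 x) /\ lambda < `|f x|]
      = 0%E.
Proof.
move=> beta0 betad l0 [qf _] lambda0 avgQ.
pose avg (k : int * ('I_d -> int)) := (((dside l k.1 `^ beta)^-1)%:E *
  choquet beta a l (dcube a l k.1 k.2) (fun x => `|f x|%R))%E.
pose G k : Prop := (lambda%:E < avg k)%E.
have sb n : 0 < dside l n `^ beta by rewrite powR_gt0// dside_gt0.
have notG (n : nat) x : ~ G (n%:Z, didx a l n x) ->
    (choquet beta a l (dcube a l n (didx a l n x)) (fun y => `|f y|%R) <=
     (lambda * dside l n `^ beta)%:E)%E.
  by move=> /negP; rewrite -leNgt /avg lee_pdivrMl// -EFinM mulrC.
have dside0 : dside l 0 = l by rewrite /dside oppr0 expr0z mulr1.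
pose K : set (int * ('I_d -> int)) := [set k | exists x n,
  [/\ cube a l x, first_at a l G x n & k = (n%:Z, didx a l n x)]].
exists K; split; first exact: countable_fun_ord.
split.
  move=> _ [x [n [Qx _ ->]]] /=.
  by rewrite -[X in _ `<=` X](dcube0E l0 Qx); exact: dcube_sub.
split.
  move=> _ _ [x [n [_ fx ->]]] [y [p [_ fy ->]]] /= ne.
  rewrite -subset0 => z [xz yz]; apply: ne.
  (* A common point [z] stops at both generations, so they agree and both cubes are the one around
     [z]. *)
  have nz := first_at_sub l0 fx xz; have pz := first_at_sub l0 fy yz.
  move: xz yz => /(dcubeP a l0) -> /(dcubeP a l0) ->.
  by rewrite (first_at_inj nz pz).
split.
  move=> _ [x [n [Qx [Gx Hx] ->]]] /=; split; first exact: Gx.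
  (* Generation 0 is the given cube, excluded by [avgQ]; so a selected cube has a parent of
     generation at least 0, to which minimality applies. *)
  case: n Gx Hx => [Gx _|n Gx Hx].
    by move: Gx; rewrite /G /avg /= dcube0E// dside0 ltNge avgQ.
  have np := notG n x (Hx n (ltnSn n)).
  have sE : dside l n = 2 * dside l n.+1.
    by rewrite (dsideD l n 1) expr1 -PoszD addn1.
  have sub : dcube a l n.+1 (didx a l n.+1 x) `<=` dcube a l n (didx a l n x).
    by apply: dcube_sub => //; rewrite lez_nat leqnSn.
  rewrite lee_pdivrMl// -EFinM; apply: le_trans (le_choquet beta a l _ sub) _.
  apply: le_trans np _; rewrite lee_fin sE powRM ?(ltW (dside_gt0 l0 _))//.
  by rewrite mulrC -mulrA mulrCA.
apply: (@Hmeasure_eq0 _ _ _ a l) => //.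
apply/eqP; rewrite eq_le Hcontent_ge0 andbT.
(* The thresholds lie strictly above [lambda], as [superlevel_null] demands, and decrease to it. *)
pose E n := [set x | (forall p : nat,
      (choquet beta a l (dcube a l p (didx a l p x)) (fun y => `|f y|%R) <=
       (lambda * dside l p `^ beta)%:E)%E) /\ lambda + n.+1%:R^-1 < `|f x|].
rewrite -(@Hcontent_bigcup0 _ _ beta a l E); last first.
  by move=> n; apply: superlevel_null => //; rewrite ltrDl invr_gt0.
apply: le_Hcontent => x [Qx [nK fx]].
have /ltr_add_invr[n fn] := fx.
(* Were some average around [x] above [lambda], the first such cube would belong to [K] and contain
   [x]. *)
exists n => //; split=> // p; apply: notG => Gp.
have [q _ fq] := first_atP Gp.
by apply: nK; exists (q%:Z, didx a l q x); split; [exists x, q|exact: dcube_didx].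
Qed.
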